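(* Consider a strip-plot design with $B\ge 2$ blocks, each a $P\times Q$ array of units, $P,Q\ge2$, and let $l(pq)$ ($1\le p\le P$, $1\le q\le Q$) be known real constants, not all zero, summing to zero. Let the range of each potential outcome be a nondegenerate interval $T\subseteq\mathbb{R}$. Let $V$ be the class of variance estimators defined in the context, each member of which has bias $\Delta=\bar\tau_{\rm vec}'U\bar\tau_{\rm vec}$ for the matrix $U$ associated with it in the context, where $\bar\tau_{\rm vec}=(\bar\tau_1,\dots,\bar\tau_B)'$. Then the variance estimator $$\widehat{\operatorname{var}}_0(\hat{\bar\tau})=\frac{1}{B(B-1)}\sum_{b=1}^B(\hat{\bar\tau}_b-\hat{\bar\tau})^2$$ is uniquely minimax in the class $V$ in the sense of minimizing the maximum bias over $\{\bar\tau_{\rm vec}:\bar\tau_{\rm vec}'\bar\tau_{\rm vec}=\rho^2\}$, for every $\rho>0$. That is, $\widehat{\operatorname{var}}_0(\hat{\bar\tau})$ belongs to $V$ and, for every $\rho>0$, it is the unique member of $V$ minimizing $\max\{\bar\tau_{\rm vec}'U\bar\tau_{\rm vec}:\ \bar\tau_{\rm vec}\in\mathbb{R}^B,\ \bar\tau_{\rm vec}'\bar\tau_{\rm vec}=\rho^2\}$.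
   Context: Setup. Factors $F$ and $G$ have levels $1,\dots,P$ and $1,\dots,Q$ respectively ($P,Q\ge 2$); the treatment combinations are $pq$, $1\le p\le P$, $1\le q\le Q$. There are $BPQ$ experimental units arranged in $B\ge 2$ blocks, each block being a $P\times Q$ array of units (rows $r=1,\dots,P$, columns $c=1,\dots,Q$). Strip-plot randomization: independently for each block $b$, and independently for rows and columns within each block, the levels $1,\dots,P$ of $F$ are assigned to the $P$ rows by a uniformly random permutation (one row per level), and the levels $1,\dots,Q$ of $G$ are assigned to the $Q$ columns by a uniformly random permutation (one column per level). The unit in block $b$ assigned to treatment combination $pq$ is the one whose row is assigned to level $p$ of $F$ and whose column is assigned to level $q$ of $G$. Potential outcomes: $Y_b(rc;pq)\in T$ is a fixed (nonrandom) real number, the outcome of the unit at row $r$ and column $c$ of block $b$ when exposed to treatment combination $pq$; the array of potential outcomes is unknown and may be any array with entries in $T$. All randomness comes from the randomization; expectation $E$ and variance are with respect to it. $Y_b^{\rm obs}(pq)$ denotes the outcome observed in block $b$ from the unit assigned to $pq$, i.e. $Y_b^{\rm obs}(pq)=Y_b(rc;pq)$ with $r$, $c$ the (random) row and column in block $b$ assigned to level $p$ of $F$ and level $q$ of $G$. Definitions: $\bar Y_b(pq)=\frac{1}{PQ}\sum_{r=1}^P\sum_{c=1}^Q Y_b(rc;pq)$; $\bar\tau_b=\sum_{p=1}^P\sum_{q=1}^Q l(pq)\bar Y_b(pq)$; $\bar\tau=\frac1B\sum_{b=1}^B\bar\tau_b$; $\hat{\bar\tau}_b=\sum_{p=1}^P\sum_{q=1}^Q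 l(pq)Y_b^{\rm obs}(pq)$; $\hat{\bar\tau}=\frac1B\sum_{b=1}^B\hat{\bar\tau}_b$; $\hat{\bar\tau}_{\rm vec}=(\hat{\bar\tau}_1,\dots,\hat{\bar\tau}_B)'$. Primes denote transpose. Between-block additivity: for every pair of treatment combinations $p_1q_1$ and $p_2q_2$, the difference $\bar Y_b(p_1q_1)-\bar Y_b(p_2q_2)$ is constant over $1\le b\le B$. Class $V$: let $Y^{\rm obs}=((Y_1^{\rm obs})',\dots,(Y_B^{\rm obs})')'$ be the $BPQ\times 1$ vector of observed outcomes, where $Y_b^{\rm obs}$ is the $PQ\times1$ vector with elements $Y_b^{\rm obs}(pq)$, $1\le p\le P$, $1\le q\le Q$. $V$ consists of all estimators $\widehat{\operatorname{var}}(\hat{\bar\tau})=(Y^{\rm obs})'A\,(Y^{\rm obs})$, where $A$ is a known (constant) symmetric nonnegative definite (positive semidefinite) matrix of order $BPQ$, such that $E\{\widehat{\operatorname{var}}(\hat{\bar\tau})\}=\operatorname{var}(\hat{\bar\tau})$ whenever the potential outcomes (with values in $T$) satisfy between-block additivity. Matrix $U$ and bias: every member of $V$ can be written as $\widehat{\operatorname{var}}(\hat{\bar\tau})=\hat{\bar\tau}_{\rm vec}'U\hat{\bar\tau}_{\rm vec}$ with $U$ a constant nonnegative definite matrix of order $B$ having each diagonal element $1/B^2$ and each row sum zero, and then its bias is $\Delta=E\{\widehat{\operatorname{var}}(\hat{\bar\tau})\}-\operatorname{var}(\hat{\bar\tau})=\bar\tau_{\rm vec}'U\bar\tau_{\rm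 vec}$. The maximum bias over a sphere refers to the maximum of this quadratic form over all vectors $\bar\tau_{\rm vec}\in\mathbb{R}^B$ on the sphere. *)

(* Defs.v *)
From HB Require Import structures.
From mathcomp Require Import all_boot all_order all_algebra all_fingroup.
From mathcomp Require Import all_classical all_reals all_analysis.

Set Implicit Arguments.
Unset Strict Implicit.
Unset Printing Implicit Defensive.

Import Order.TTheory GRing.Theory Num.Theory.
Local Open Scope classical_set_scope.
Local Open Scope ring_scope.

Section Matrices.
Context {R : realType}.

Definition qform n (A : 'M[R]_n) (x : 'cV[R]_n) : R := (x^T *m A *m x) 0 0.

Definition nonneg_definite n (A : 'M[R]_n) : Prop :=
  A^T = A /\ forall x : 'cV[R]_n, 0 <= qform A x.

Definition sphere n (rho : R) : set 'cV[R]_n :=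
  [set x | (x^T *m x) 0 0 = rho ^+ 2].

(* The maximum is attained: [m] belongs to [S]. *)
Definition is_maximum (S : set R) (m : R) : Prop := S m /\ ubound S m.

End Matrices.

Section UniformExpectation.
Context {R : realType} {Omega : finType}.

Definition expect (X : Omega -> R) : R := (\sum_w X w) / #|Omega|%:R.

Definition variance (X : Omega -> R) : R :=
  expect (fun w => (X w - expect X) ^+ 2).

End UniformExpectation.

(* An outcome [w] of the strip-plot randomization: [(w b).1 p] is the row of   *)
(* block [b] assigned to level [p] of F and [(w b).2 q] the column assigned to *)
(* level [q] of G. The uniform law on this product makes all these             *)
(* permutations uniform and mutually independent.                              *)
Definition randomization (B P Q : nat) : finType :=
  {ffun 'I_B -> 'S_P * 'S_Q}.

Section StripPlot.
Context {R : realType} {B P Q : nat}.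

(* [Y b r c p q] is the outcome of the unit in row [r] and column [c] of block *)
(* [b] under the treatment combination [pq].                                   *)
Definition outcomes := 'I_B -> 'I_P -> 'I_Q -> 'I_P -> 'I_Q -> R.

Definition observation := 'I_B -> 'I_P -> 'I_Q -> R.

Definition valued_in (T : set R) (Y : outcomes) : Prop :=
  forall b r c p q, T (Y b r c p q).

Definition Yobs (Y : outcomes) (w : randomization B P Q) : observation :=
  fun b p q => Y b ((w b).1 p) ((w b).2 q) p q.

Definition Ybar (Y : outcomes) (b : 'I_B) (p : 'I_P) (q : 'I_Q) : R :=
  (\sum_(r < P) \sum_(c < Q) Y b r c p q) / (P%:R * Q%:R).

Definition between_block_additive (Y : outcomes) : Prop :=
  forall p1 q1 p2 q2 (b b' : 'I_B),
    Ybar Y b p1 q1 - Ybar Y b p2 q2 = Ybar Y b' p1 q1 - Ybar Y b' p2 q2.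

Variable l : 'I_P -> 'I_Q -> R.

Definition taubar_vec (Y : outcomes) : 'cV[R]_B :=
  \col_b \sum_p \sum_q l p q * Ybar Y b p q.

Definition tauhat_vec (D : observation) : 'cV[R]_B :=
  \col_b \sum_p \sum_q l p q * D b p q.

Definition tauhat (D : observation) : R :=
  (\sum_b tauhat_vec D b 0) / B%:R.

(* The vector of order BPQ stacking the blocks, with the treatment             *)
(* combinations in lexicographic order within each block.                      *)
Definition stack (D : observation) : 'cV[R]_(B * (P * Q)) :=
  (mxvec (\matrix_(b < B) mxvec (\matrix_(p < P, q < Q) D b p q)))^T.

Definition estimator := observation -> R.

Definition var0 : estimator := fun D =>
  (B%:R * (B%:R - 1))^-1 * \sum_b (tauhat_vec D b 0 - tauhat D) ^+ 2.

Definition Eest (f : estimator) (Y : outcomes) : R :=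
  expect (fun w : randomization B P Q => f (Yobs Y w)).

Definition var_tauhat (Y : outcomes) : R :=
  variance (fun w : randomization B P Q => tauhat (Yobs Y w)).

Definition classV (T : set R) : set estimator := [set f |
  exists A : 'M[R]_(B * (P * Q)),
    [/\ nonneg_definite A,
        forall D, f D = qform A (stack D) &
        forall Y, valued_in T Y -> between_block_additive Y ->
          Eest f Y = var_tauhat Y]].

Definition bias_matrix (T : set R) (f : estimator) (U : 'M[R]_B) : Prop :=
  [/\ nonneg_definite U,
      forall b, U b b = B%:R ^- 2,
      forall b, \sum_b' U b b' = 0,
      forall D, f D = qform U (tauhat_vec D) &
      forall Y, valued_in T Y ->
        Eest f Y - var_tauhat Y = qform U (taubar_vec Y)].

(* [unique] makes [U] the matrix associated with [f], not merely a possible    *)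
(* choice of such a matrix.                                                    *)
Definition max_bias (T : set R) (f : estimator) (rho m : R) : Prop :=
  exists U : 'M[R]_B, unique (bias_matrix T f) U /\
    is_maximum [set qform U t | t in sphere rho] m.

(* [max_bias] being a relation, the existence of the maximum bias of every     *)
(* member of the class is part of the claim.                                   *)
Definition minimax (T : set R) (rho : R) (f : estimator) : Prop :=
  classV T f /\
  exists m, max_bias T f rho m /\
    forall g, classV T g -> exists m', max_bias T g rho m' /\ m <= m'.

End StripPlot.

Arguments outcomes : clear implicits.
Arguments observation : clear implicits.
Arguments estimator : clear implicits.

(* Main.v *)
Require Import Defs.
From HB Require Import structures.
From mathcomp Require Import all_boot all_order all_algebra all_fingroup.
From mathcomp Require Import all_classical all_reals all_analysis.
From mathcomp Require Import ring lra.

Set Implicit Arguments.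
Unset Strict Implicit.
Unset Printing Implicit Defensive.

Import Order.TTheory GRing.Theory Num.Theory.
Import numFieldNormedType.Exports.
Local Open Scope classical_set_scope.
Local Open Scope ring_scope.

(** Every member of the class is a quadratic form in the block contrasts alone,
and among the matrices of such forms the centering matrix, suitably scaled, has
the smallest largest value on a sphere.

Let [A] be the nonnegative definite matrix of a member. Its unbiasedness is
first freed from the range [T] ([unbiased_extend]): any array can be rescaled
and shifted into [T], the shift is invisible because a constant array makes the
variance of the estimated contrast zero and so lies in the kernel of [A], and
both sides of the unbiasedness equation are homogeneous of degree two.
Potential outcomes that differ between units only through the row, in a single
block and with centred row effects, are then additive with all block means
zero. Their unbiasedness equations determine [A] inside a block: it takes the
value (l'v / B)^2 on a vector v of block observations ([qform_in_block]). Hence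
[A] vanishes on block vectors with contrast zero, and a nonnegative definite
matrix that vanishes on a vector annihilates it ([nonneg_definite_ker]). So
the estimator depends on the observations only through the estimated
contrasts, through a matrix [U] with diagonal entries 1 / B^2; the rows of [U]
sum to zero because outcomes without unit effects, equal to [l] in each block,
are additive with variance zero ([unbiased_reduction]). Conversely each such
[U] gives a member of the class ([classV_estimator_of]): the blocks are
independent, and the block variances in the mean of the estimator cancel those
in the variance of the estimated contrast ([bias_tauhat_qform]).

Now let m be the maximum of [qform U] on the sphere of radius rho. Since [U]
annihilates constant vectors, [qform U t] is at most m / rho^2 times the squared
length of the deviations of [t] from its mean ([qform_le_centering]). At a
basis vector this reads 1 / B^2 <= (m / rho^2) (1 - 1 / B), that is
m >= rho^2 / (B (B - 1)). In the case of equality the difference of the two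
sides is a nonnegative definite form with null diagonal, hence zero, so [U] is
the centering matrix divided by B (B - 1), which is the matrix of [var0]. *)

(** * Quadratic forms *)

Section QuadraticForms.
Context {R : realType}.

Definition bform n (A : 'M[R]_n) (x y : 'cV[R]_n) : R := (x^T *m A *m y) 0 0.

Lemma bformE n (A : 'M[R]_n) x y :
  bform A x y = \sum_i \sum_j x i 0 * A i j * y j 0.
Proof.
rewrite /bform mxE exchange_big; apply: eq_bigr => j _.
by rewrite mxE mulr_suml; apply: eq_bigr => i _; rewrite !mxE.
Qed.

Lemma qformE n (A : 'M[R]_n) x :
  qform A x = \sum_i \sum_j x i 0 * A i j * x j 0.
Proof. exact: bformE. Qed.

Lemma bformC n (A : 'M[R]_n) x y : A^T = A -> bform A x y = bform A y x.
Proof.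
move=> symA; rewrite !bformE exchange_big; apply: eq_bigr => i _.
by apply: eq_bigr => j _; rewrite -[in RHS]symA mxE; ring.
Qed.

Lemma qformD n (A : 'M[R]_n) x y : A^T = A ->
  qform A (x + y) = qform A x + 2%:R * bform A x y + qform A y.
Proof.
have trD : (x + y)^T = x^T + y^T by rewrite linearD.
have addE (M N : 'M[R]_1) : (M + N) 0 0 = M 0 0 + N 0 0 by rewrite mxE.
move=> symA; have := bformC y x symA; rewrite /bform /qform trD.
by rewrite !mulmxDl !mulmxDr !addE => ->; ring.
Qed.

Lemma qformZ n (A : 'M[R]_n) a x : qform A (a *: x) = a ^+ 2 * qform A x.
Proof.
have trZ : (a *: x)^T = a *: x^T by rewrite linearZ.
by rewrite /qform trZ -!scalemxAl -scalemxAr scalerA mxE expr2.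
Qed.

Lemma qformZl n (A : 'M[R]_n) a x : qform (a *: A) x = a * qform A x.
Proof. by rewrite /qform -scalemxAr -scalemxAl mxE. Qed.

Lemma qformBl n (A C : 'M[R]_n) x : qform (A - C) x = qform A x - qform C x.
Proof.
rewrite /qform mulmxBr mulmxBl mxE; congr (_ + _).
by rewrite mxE.
Qed.

Lemma qform_congr m n (A : 'M[R]_m) (L : 'M[R]_(m, n)) x :
  qform (L^T *m A *m L) x = qform A (L *m x).
Proof. by rewrite /qform trmx_mul !mulmxA. Qed.

Lemma qform_addl_ker n (A : 'M[R]_n) x y :
  A^T = A -> A *m x = 0 -> qform A (x + y) = qform A y.
Proof.
move=> symA Ax0; rewrite qformD // (bformC x y symA) /qform /bform.
by rewrite -!(mulmxA _ A) Ax0 !mulmx0 !mxE mulr0 !add0r.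
Qed.

Lemma qform_delta n (A : 'M[R]_n) i : qform A (delta_mx i 0) = A i i.
Proof. by rewrite /qform trmx_delta -rowE -colE !mxE. Qed.

(** Polarization on the pairs of basis vectors. *)
Lemma qform_inj n (A C : 'M[R]_n) :
  A^T = A -> C^T = C -> qform A =1 qform C -> A = C.
Proof.
move=> symA symC AC; apply/matrixP => i j.
have := AC (delta_mx i 0 + delta_mx j 0).
rewrite !qformD // !AC /bform trmx_delta -!rowE -!colE !mxE.
by move=> /addIr /addrI /mulfI -> //; rewrite pnatr_eq0.
Qed.

Lemma dotE n (x : 'cV[R]_n) : (x^T *m x) 0 0 = \sum_i x i 0 ^+ 2.
Proof. by rewrite mxE; apply: eq_bigr => i _; rewrite mxE expr2. Qed.

Lemma dot_eq0 n (x : 'cV[R]_n) : (x^T *m x) 0 0 = 0 -> x = 0.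
Proof.
rewrite dotE => /eqP; rewrite psumr_eq0 => [/allP x0|i _]; last exact: sqr_ge0.
apply/colP => i; rewrite mxE; apply/eqP; rewrite -sqrf_eq0.
by apply: x0; rewrite mem_index_enum.
Qed.

(** If [A *m x] were not zero, a small step from [x] in the direction
[- A *m x] would, to first order in the step, take the form below zero. *)
Lemma nonneg_definite_ker n (A : 'M[R]_n) x :
  nonneg_definite A -> qform A x = 0 -> A *m x = 0.
Proof.
move=> [symA Age0] x0; apply: dot_eq0.
set y := A *m x; set a := (y^T *m y) 0 0; set c := qform A y.
have c_ge0 : 0 <= c by exact: Age0.
have ayx : bform A x y = a.
  by rewrite /bform /a /y trmx_mul symA.
(* With this step length, [qform A (x - t *: y)] is [- t^2 (c + 2)]. *)
pose t := a / (c + 1).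
have at_ : a = t * (c + 1) by rewrite /t divfK // gt_eqF // ltr_wpDl.
have := Age0 (x + (- t) *: y).
rewrite qformD // qformZ x0 -/c.
have -> : bform A x (- t *: y) = - t * a.
  by rewrite /bform -scalemxAr mxE -/(bform _ _ _) ayx.
have -> : 0 + 2%:R * (- t * a) + (- t) ^+ 2 * c = - (t ^+ 2 * (c + 2%:R)).
  by rewrite [in LHS]at_; ring.
rewrite oppr_ge0 pmulr_lle0 ?ltr_wpDl ?ltr0n // => t2.
have /eqP : t ^+ 2 = 0 by apply/le_anti; rewrite t2 sqr_ge0.
by rewrite sqrf_eq0 => /eqP t0; rewrite at_ t0 mul0r.
Qed.

Lemma sqr_mean n (t : 'cV[R]_n) :
  ((\sum_b t b 0) / n%:R) ^+ 2 = qform (const_mx (n%:R ^- 2)) t.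
Proof.
rewrite exprMn qformE expr2 mulr_suml mulr_suml; apply: eq_bigr => b _.
rewrite mulr_sumr mulr_suml; apply: eq_bigr => b' _.
by rewrite [const_mx _ _ _]mxE exprVn mulrAC.
Qed.

End QuadraticForms.

(** * The largest value of a form on a sphere *)

Section Maximum.
Context {R : realType} {n : nat}.

Lemma qform_continuous (U : 'M[R]_n) :
  continuous (fun u : 'rV[R]_n => qform U u^T).
Proof.
have -> : (fun u : 'rV[R]_n => qform U u^T) =
    (fun u => \sum_i \sum_j u 0 i * U i j * u 0 j).
  apply/funext => u; rewrite qformE.
  by do 2!apply: eq_bigr => ? _; rewrite !mxE.
apply: continuous_big => [|i _]; first exact: add_continuous.
apply: continuous_big => [|j _ u]; first exact: add_continuous.
have cX k : {for u, continuous (fun u : 'rV[R]_n => u 0 k)}.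
  exact: coord_continuous.
exact: (cvgM (cvgM (cX i) (cvg_cst (U i j))) (cX j)).
Qed.

Lemma qform1 (t : 'cV[R]_n) : qform 1%:M t = (t^T *m t) 0 0.
Proof. by rewrite /qform mulmx1. Qed.

(** Extreme value theorem, on the sphere transposed to row vectors. *)
Lemma sphere_max (U : 'M[R]_n) (rho : R) : (0 < n)%N -> 0 <= rho ->
  exists m, is_maximum [set qform U t | t in sphere (n := n) rho] m.
Proof.
move=> n0 rho0; pose S := [set u : 'rV[R]_n | qform 1%:M u^T = rho ^+ 2].
have S0 : S !=set0.
  exists (rho *: delta_mx 0 (Ordinal n0)).
  rewrite /S /=.
  have -> : qform 1%:M (rho *: delta_mx (0 : 'I_1) (Ordinal n0))^T =
      qform (1%:M : 'M[R]_n) (rho *: delta_mx (Ordinal n0) 0).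
    by congr qform; rewrite linearZ /= trmx_delta.
  by rewrite qformZ qform_delta mxE eqxx mulr1.
have cS : compact S.
  have cK : compact [set u : 'rV[R]_n | forall i, u ord0 i \in `[- rho, rho]].
    apply: (@rV_compact _ _ (fun=> `[- rho, rho]%classic)) => _.
    exact: segment_compact.
  apply: subclosed_compact cK _.
    apply: (@closed_comp _ _ (fun u : 'rV[R]_n => qform 1%:M u^T)
      [set y | y = rho ^+ 2]) => [u _|]; first exact: qform_continuous.
    exact: closed_eq.
  move=> u; rewrite /S /= qform1 dotE => Su i.
  rewrite in_itv /= -ler_norml -ler_sqr ?nnegrE // -normrX.
  rewrite ger0_norm ?sqr_ge0 // -Su (bigD1 i) //= mxE lerDl.
  by rewrite sumr_ge0 // => j _; exact: sqr_ge0.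
have [c cS' cmax] :=
  EVT_max_rV S0 cS (continuous_subspaceT (@qform_continuous U)).
exists (qform U c^T); split.
  by exists c^T => //; move: cS'; rewrite inE /S /= qform1.
move=> _ [t St <-]; rewrite -[t]trmxK; apply: cmax.
by rewrite inE /S /= trmxK qform1.
Qed.

End Maximum.

Section Minimax.
Context {R : realType} {B : nat}.
Hypothesis B1 : (1 < B)%N.
Implicit Types (U : 'M[R]_B) (t : 'cV[R]_B).

Definition centering : 'M[R]_B := 1%:M - const_mx B%:R^-1.

Let B0 : B%:R != 0 :> R. Proof. by rewrite pnatr_eq0 -lt0n ltnW. Qed.
Let B10 : 0 < B%:R - 1 :> R. Proof. by rewrite subr_gt0 ltr1n. Qed.
Let Bgt0 : 0 < B%:R :> R. Proof. by rewrite ltr0n ltnW. Qed.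

Lemma qform_centering t :
  qform centering t = (t^T *m t) 0 0 - (\sum_b t b 0) ^+ 2 / B%:R.
Proof.
rewrite qformBl qform1; congr (_ - _).
have -> : const_mx B%:R^-1 = B%:R *: const_mx (B%:R ^- 2) :> 'M[R]_B.
  by apply/matrixP => i j; rewrite !mxE; field.
by rewrite qformZl -sqr_mean; field.
Qed.

Lemma qform_centering_dev t :
  qform centering t = \sum_b (t b 0 - (\sum_b t b 0) / B%:R) ^+ 2.
Proof.
rewrite qform_centering dotE; set s := \sum_b t b 0.
transitivity (\sum_b (t b 0 ^+ 2 + (- 2%:R * (s / B%:R)) * t b 0 +
    (s / B%:R) ^+ 2)).
  rewrite 2!big_split /= -mulr_sumr sumr_const card_ord -/s.
  by rewrite -[_ *+ B]mulr_natr; field.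
by apply: eq_bigr => b _; ring.
Qed.

Lemma centering_psd : nonneg_definite centering.
Proof.
split=> [|t]; first by apply/matrixP => i j; rewrite !mxE eq_sym.
by rewrite qform_centering_dev sumr_ge0 // => b _; exact: sqr_ge0.
Qed.

Lemma centering_diag b : centering b b = 1 - B%:R^-1.
Proof. by rewrite !mxE eqxx. Qed.

(** The matrices attached to the members of the class: the mean of the form
must contain each block variance with the weight 1 / B^2 that it has in the
variance of the average contrast, and the form must vanish on constant vectors,
which are the contrasts of additive outcomes. *)
Definition weight_mx U : Prop :=
  [/\ nonneg_definite U, forall b, U b b = B%:R ^- 2 &
      forall b, \sum_b' U b b' = 0].

Lemma row_sum0_ker U (a : R) :
  (forall b, \sum_b' U b b' = 0) -> U *m const_mx a = 0 :> 'cV_B.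
Proof.
move=> U0; apply/colP => b.
rewrite [RHS]mxE -[RHS](mul0r a) -[X in X * a](U0 b) mulr_suml.
by rewrite mxE; apply: eq_bigr => b' _; rewrite [const_mx _ _ _]mxE.
Qed.

Definition var0_mx : 'M[R]_B := (B%:R * (B%:R - 1))^-1 *: centering.

Let k : R := (B%:R * (B%:R - 1))^-1.
Let k0 : 0 < k. Proof. by rewrite invr_gt0 mulr_gt0. Qed.
Let B1_neq0 : B%:R - 1 != 0 :> R. Proof. by rewrite gt_eqF. Qed.

Lemma var0_mx_weights : weight_mx var0_mx.
Proof.
have [symC Cge0] := centering_psd; split.
- split=> [|t]; first by rewrite linearZ /= symC.
  by rewrite qformZl mulr_ge0 // ltW.
- by move=> b; rewrite mxE centering_diag; field; rewrite B0 B1_neq0.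
- move=> b; under eq_bigr do rewrite mxE.
  rewrite -mulr_sumr; under eq_bigr do rewrite !mxE.
  rewrite sumrB sumr_const card_ord -[_^-1 *+ B]mulr_natr mulVf //.
  rewrite (bigD1 b) //= eqxx big1 => [|b' /negPf]; last by rewrite eq_sym => ->.
  by rewrite addr0 subrr mulr0.
Qed.

(** [U] annihilates constant vectors, so only the deviations of [t] from its
mean matter; rescaled to length [rho], they lie on the sphere. *)
Lemma qform_le_centering U (rho m : R) : 0 < rho -> weight_mx U ->
  is_maximum [set qform U t | t in sphere rho] m ->
  forall t, qform U t <= m / rho ^+ 2 * qform centering t.
Proof.
move=> rho0 [[symU _] _ U0] [_ m_ub] t.
pose c : 'cV[R]_B := const_mx ((\sum_b t b 0) / B%:R).
pose d := t - c; have dE : qform centering t = (d^T *m d) 0 0.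
  by rewrite qform_centering_dev dotE; apply: eq_bigr => b _; rewrite !mxE.
have -> : qform U t = qform U d.
  by rewrite -[t](subrK c) -/d addrC qform_addl_ker // row_sum0_ker.
rewrite dE; set N := (d^T *m d) 0 0.
have [d0|d_neq0] := eqVneq N 0.
  by rewrite /qform (dot_eq0 d0) mulmx0 d0 mulr0 mxE.
have N0 : 0 < N.
  by rewrite lt_neqAle eq_sym d_neq0 /N dotE sumr_ge0 // => i _; exact: sqr_ge0.
have r2 : (rho / Num.sqrt N) ^+ 2 = rho ^+ 2 / N.
  by rewrite exprMn exprVn sqr_sqrtr // ltW.
have : qform U ((rho / Num.sqrt N) *: d) <= m.
  apply: m_ub; exists ((rho / Num.sqrt N) *: d) => //.
  by rewrite /sphere /= -qform1 qformZ qform1 -/N r2 divfK.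
rewrite qformZ r2 => h.
have -> : m / rho ^+ 2 * N = m * (N / rho ^+ 2) by ring.
have -> : qform U d = rho ^+ 2 / N * qform U d * (N / rho ^+ 2).
  by field; rewrite d_neq0 gt_eqF.
by rewrite ler_wpM2r // ltW // divr_gt0 // exprn_gt0.
Qed.

(** The previous bound at a basis vector compares the diagonals of [U] and of
the centering matrix. *)
Lemma sphere_maximum_ge U (rho m : R) : 0 < rho -> weight_mx U ->
  is_maximum [set qform U t | t in sphere rho] m -> rho ^+ 2 * k <= m.
Proof.
move=> rho0 admU maxm.
have := qform_le_centering rho0 admU maxm (delta_mx (Ordinal (ltnW B1)) 0).
have [_ Ubb _] := admU; rewrite !qform_delta Ubb centering_diag => h.
have -> : m = m / rho ^+ 2 * (1 - B%:R^-1) * (B%:R / (B%:R - 1)) * rho ^+ 2.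
  by field; rewrite B0 B1_neq0 gt_eqF.
have -> : rho ^+ 2 * k = B%:R ^- 2 * (B%:R / (B%:R - 1)) * rho ^+ 2.
  by rewrite /k; field; rewrite B0 B1_neq0.
by rewrite ler_wpM2r ?sqr_ge0 // ler_wpM2r // divr_ge0 // ltW.
Qed.

(** Centering does not lengthen a vector. *)
Lemma sphere_maximum_var0_mx_le (rho m : R) :
  is_maximum [set qform var0_mx t | t in sphere rho] m -> m <= rho ^+ 2 * k.
Proof.
move=> [[t St <-] _]; rewrite qformZl mulrC (ler_wpM2r (ltW k0)) //.
by rewrite qform_centering St lerBlDr lerDl divr_ge0 ?sqr_ge0 // ltW.
Qed.

(** In the extremal case [qform_le_centering] says that [var0_mx - U] is
nonnegative definite; its diagonal is zero, so it annihilates the basis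
vectors. *)
Lemma sphere_maximum_eq_var0_mx U (rho m : R) : 0 < rho -> weight_mx U ->
  is_maximum [set qform U t | t in sphere rho] m -> m <= rho ^+ 2 * k ->
  U = var0_mx.
Proof.
move=> rho0 admU maxm m_le.
have mE : m = rho ^+ 2 * k.
  by apply/le_anti; rewrite m_le (sphere_maximum_ge rho0 admU maxm).
have U_le := qform_le_centering rho0 admU maxm.
have lamE : m / rho ^+ 2 = k.
  by rewrite mE mulrAC divff ?mul1r // sqrf_eq0 gt_eqF.
have [[symU _] Ubb _] := admU.
have [[symM _] Mbb _] := var0_mx_weights.
have W_psd : nonneg_definite (var0_mx - U).
  split=> [|t]; first by rewrite linearB /= symM symU.
  by rewrite qformBl subr_ge0 qformZl -/k -lamE.
apply/eqP; rewrite eq_sym -subr_eq0; apply/eqP/matrixP => i j.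
transitivity (((var0_mx - U) *m delta_mx j 0) i (0 : 'I_1)).
  by rewrite -colE [RHS]mxE.
rewrite nonneg_definite_ker ?mxE // qform_delta mxE Mbb [X in _ + X]mxE Ubb.
by rewrite subrr.
Qed.

End Minimax.

(** * Stacked observations and block contrasts *)

Section Stack.
Context {R : realType} {B P Q : nat}.
Implicit Types (D : observation R B P Q) (x : 'cV[R]_(B * (P * Q))).

Definition unstack x : observation R B P Q :=
  fun b p q => x (mxvec_index b (mxvec_index p q)) 0.

Lemma stackE D b p q : stack D (mxvec_index b (mxvec_index p q)) 0 = D b p q.
Proof. by rewrite mxE mxvecE mxE mxvecE mxE. Qed.

Lemma unstackK x : stack (unstack x) = x.
Proof.
apply/colP => k; case/mxvec_indexP: k => b k; case/mxvec_indexP: k => p q.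
by rewrite stackE.
Qed.

Lemma eq_stack D D' : (forall b p q, D b p q = D' b p q) -> stack D = stack D'.
Proof.
move=> DD'; apply/colP => k; case/mxvec_indexP: k => b k.
by case/mxvec_indexP: k => p q; rewrite !stackE.
Qed.

Lemma stack_lincomb D D' a :
  stack (fun b p q => a * D b p q + D' b p q) = a *: stack D + stack D'.
Proof.
apply/colP => k; case/mxvec_indexP: k => b k; case/mxvec_indexP: k => p q.
by rewrite !mxE !mxvecE !mxE !mxvecE !mxE.
Qed.

Lemma dot_stack D D' :
  ((stack D)^T *m stack D') 0 0 = \sum_b \sum_p \sum_q D b p q * D' b p q.
Proof.
have sum_mxvec m n (F : 'I_(m * n) -> R) :
    \sum_k F k = \sum_i \sum_j F (mxvec_index i j).
  by rewrite (reindex _ (curry_mxvec_bij m n)) pair_bigA; apply: eq_bigr => -[].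
rewrite mxE sum_mxvec; apply: eq_bigr => b _; rewrite sum_mxvec.
by apply: eq_bigr => p _; apply: eq_bigr => q _; rewrite mxE !stackE.
Qed.

Variable l : 'I_P -> 'I_Q -> R.

Definition contrast_mx : 'M[R]_(B, B * (P * Q)) :=
  \matrix_(b < B) (stack (fun b' p q => (b' == b)%:R * l p q))^T.

Lemma sum_block (b : 'I_B) (F : 'I_B -> R) : \sum_b' (b' == b)%:R * F b' = F b.
Proof.
rewrite (bigD1 b) //= eqxx mul1r big1 ?addr0 // => b' /negPf ->.
by rewrite mul0r.
Qed.

Lemma tauhat_vecE D : tauhat_vec l D = contrast_mx *m stack D.
Proof.
apply/colP => b.
have -> : (contrast_mx *m stack D) b 0 =
    ((stack (fun b' p q => (b' == b)%:R * l p q))^T *m stack D) 0 0.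
  by rewrite !mxE; apply: eq_bigr => k _; rewrite !mxE.
rewrite dot_stack mxE -(sum_block b (fun b => \sum_p \sum_q l p q * D b p q)).
apply: eq_bigr => b' _; rewrite mulr_sumr; apply: eq_bigr => p _.
by rewrite mulr_sumr; apply: eq_bigr => q _; rewrite mulrA.
Qed.

Definition sqnorm : R := \sum_p \sum_q l p q ^+ 2.

Lemma sqnorm_gt0 : (exists p q, l p q != 0) -> 0 < sqnorm.
Proof.
move=> [p [q lpq]]; rewrite /sqnorm (bigD1 p) //= (bigD1 q) //=.
rewrite ltr_wpDr ?sumr_ge0 // => [i _|].
  by rewrite sumr_ge0 // => j _; exact: sqr_ge0.
rewrite ltr_wpDr ?sumr_ge0 // => [i _|]; first exact: sqr_ge0.
by rewrite exprn_even_gt0.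
Qed.

Lemma tr_contrast_mx (t : 'cV[R]_B) :
  contrast_mx^T *m t = stack (fun b p q => t b 0 * l p q).
Proof.
apply/colP => k; case/mxvec_indexP: k => b k; case/mxvec_indexP: k => p q.
rewrite stackE -(sum_block b (fun b => t b 0 * l p q)) mxE.
apply: eq_bigr => b' _; rewrite !mxE mxvecE mxE mxvecE mxE eq_sym; ring.
Qed.

(** The rows of [contrast_mx] are copies of [l] with disjoint supports. *)
Lemma contrast_mxK : contrast_mx *m contrast_mx^T = sqnorm%:M.
Proof.
apply/matrixP => b b'.
have -> : (contrast_mx *m contrast_mx^T) b b' =
    (contrast_mx *m (contrast_mx^T *m delta_mx b' (0 : 'I_1))) b 0.
  by rewrite mulmxA -colE [RHS]mxE.
rewrite tr_contrast_mx -tauhat_vecE [LHS]mxE [RHS]mxE.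
rewrite /sqnorm -sumrMnl; apply: eq_bigr => p _.
rewrite -sumrMnl; apply: eq_bigr => q _; rewrite mxE eqxx andbT.
by case: eqP => _; rewrite ?mulr1n ?mulr0n; ring.
Qed.

(** Places in each block the multiple of [l] that has a prescribed contrast. *)
Definition lift_mx : 'M[R]_(B * (P * Q), B) := sqnorm^-1 *: contrast_mx^T.

Lemma contrast_lift : (exists p q, l p q != 0) -> contrast_mx *m lift_mx = 1%:M.
Proof.
move=> l0; rewrite -scalemxAr contrast_mxK scale_scalar_mx mulVf //.
by rewrite gt_eqF // sqnorm_gt0.
Qed.

End Stack.

(** * Expectation under independent uniform permutations *)

Section Expectation.
Context {R : realType}.

Section OneSpace.
Context {S : finType}.
Implicit Types X Y : S -> R.

Lemma eq_expect X Y : X =1 Y -> expect X = expect Y.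
Proof. by move=> XY; rewrite /expect (eq_bigr _ (fun w _ => XY w)). Qed.

Lemma expectD X Y : expect (fun w => X w + Y w) = expect X + expect Y.
Proof. by rewrite /expect big_split mulrDl. Qed.

Lemma expectZ a X : expect (fun w => a * X w) = a * expect X.
Proof. by rewrite /expect -mulr_sumr mulrA. Qed.

Lemma expect_sum (I : finType) (X : I -> S -> R) :
  expect (fun w => \sum_i X i w) = \sum_i expect (X i).
Proof. by rewrite /expect exchange_big /= mulr_suml. Qed.

(** The point [w0] excludes the empty space, where every expectation is zero. *)
Lemma expect_cst (w0 : S) (a : R) : expect (fun _ : S => a) = a.
Proof.
rewrite /expect sumr_const -[a *+ _]mulr_natr mulfK // pnatr_eq0 -lt0n.
by apply/card_gt0P; exists w0.
Qed.

Lemma variance_moments (w0 : S) X :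
  Defs.variance X = expect (fun w => X w ^+ 2) - expect X ^+ 2.
Proof.
rewrite /Defs.variance; set m := expect X.
have /eq_expect -> : (fun w => (X w - m) ^+ 2) =1
    (fun w => X w ^+ 2 + (- 2%:R * m * X w + m ^+ 2)).
  by move=> w; ring.
by rewrite 2!expectD expectZ (expect_cst w0) -/m; ring.
Qed.

Lemma expect_perm (f : S -> S) X : injective f ->
  expect (fun w => X (f w)) = expect X.
Proof. by move=> f_inj; rewrite /expect [in RHS](reindex_inj f_inj). Qed.

End OneSpace.

Lemma expect_pair (S T : finType) (X : S -> T -> R) :
  expect (fun u : S * T => X u.1 u.2) = expect (fun s => expect (X s)).
Proof.
rewrite /expect card_prod natrM invfM -mulr_suml mulrAC mulrA.
congr (_ / _ / _).
by rewrite pair_bigA.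
Qed.

Section Independence.
Context {n : nat} {T : finType} (t0 : T).

(** Independence of the coordinates of a uniform random function: expanding
the product of the sums lists the functions. *)
Lemma expect_prod (X : 'I_n -> T -> R) :
  expect (fun w : {ffun 'I_n -> T} => \prod_i X i (w i)) = \prod_i expect (X i).
Proof.
rewrite /expect -bigA_distr_bigA card_ffun big_split.
by rewrite prodfV prodr_const natrX.
Qed.

Let prod_at i (F : 'I_n -> R) : \prod_j (if j == i then F j else 1) = F i.
Proof. by rewrite -big_mkcond big_pred1_eq. Qed.

Lemma expect_marginal i (X : T -> R) :
  expect (fun w : {ffun 'I_n -> T} => X (w i)) = expect X.
Proof.
pose F j t := if j == i then X t else 1.
transitivity (expect (fun w : {ffun 'I_n -> T} => \prod_j F j (w j))).
  by apply: eq_expect => w; rewrite (prod_at i (fun j => X (w j))).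
rewrite (expect_prod F) /F -(prod_at i (fun=> expect X)); apply: eq_bigr => j _.
by case: eqP => // _; rewrite (expect_cst t0).
Qed.

Lemma expect_marginal2 i k (X Y : T -> R) : i != k ->
  expect (fun w : {ffun 'I_n -> T} => X (w i) * Y (w k)) = expect X * expect Y.
Proof.
move=> ik.
pose F j t := (if j == i then X t else 1) * (if j == k then Y t else 1).
transitivity (expect (fun w : {ffun 'I_n -> T} => \prod_j F j (w j))).
  apply: eq_expect => w; rewrite big_split.
  by rewrite (prod_at i (fun j => X (w j))) (prod_at k (fun j => Y (w j))).
rewrite (expect_prod F) /F -(prod_at i (fun=> expect X)).
rewrite -(prod_at k (fun=> expect Y)).
rewrite -big_split; apply: eq_bigr => j _ /=.
case: (eqVneq j i) => [->|_].
  by rewrite (negPf ik) /= mulr1; apply: eq_expect => t; rewrite mulr1.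
case: eqP => _; rewrite mul1r; first by apply: eq_expect => t; rewrite mul1r.
by rewrite (expect_cst t0).
Qed.

(** Independence leaves only the means in the off-diagonal terms; the diagonal
ones contribute a variance each. *)
Lemma expect_qform (U : 'M[R]_n) (X : 'I_n -> T -> R) :
  expect (fun w : {ffun 'I_n -> T} => qform U (\col_i X i (w i))) =
  qform U (\col_i expect (X i)) + \sum_i U i i * Defs.variance (X i).
Proof.
transitivity (\sum_i \sum_j
    expect (fun w : {ffun 'I_n -> T} => U i j * (X i (w i) * X j (w j)))).
  under [RHS]eq_bigr do rewrite -expect_sum.
  rewrite -expect_sum; apply: eq_expect => w; rewrite qformE.
  by do 2!apply: eq_bigr => ? _; rewrite !mxE mulrCA mulrA.
rewrite qformE -big_split; apply: eq_bigr => i _.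
rewrite (bigD1 i) //= [in RHS](bigD1 i) //= addrAC; congr (_ + _).
  rewrite expectZ (expect_marginal i (fun t => X i t * X i t)).
  rewrite (variance_moments t0).
  by rewrite !mxE; set e := expect _; rewrite -/e; ring.
apply: eq_bigr => j ji; rewrite expectZ expect_marginal2 1?eq_sym // !mxE.
ring.
Qed.

End Independence.

Section Permutations.
Context {n : nat}.
Implicit Types p : 'I_n.

(** Composing with a transposition shows that all points have images of the
same law, and the images of all points together run through all values. *)
Lemma expect_perm_point (F : 'I_n -> R) p :
  expect (fun s : 'S_n => F (s p)) = (\sum_r F r) / n%:R.
Proof.
have same p' : expect (fun s : 'S_n => F (s p')) =
    expect (fun s : 'S_n => F (s p)).
  rewrite -(expect_perm (fun s : 'S_n => F (s p)) (mulgI (tperm p p'))).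
  by apply: eq_expect => s; rewrite permM tpermL.
have n0 : n%:R != 0 :> R.
  by rewrite pnatr_eq0 -lt0n (leq_ltn_trans _ (ltn_ord p)).
apply: (mulIf n0); rewrite divfK //.
transitivity (\sum_(p' < n) expect (fun s : 'S_n => F (s p'))).
  by rewrite (eq_bigr _ (fun p' _ => same p')) sumr_const card_ord mulr_natr.
rewrite -expect_sum -(expect_cst (1%g : 'S_n) (\sum_r F r)).
by apply: eq_expect => s; rewrite [RHS](reindex_inj (@perm_inj _ s)).
Qed.

(** Sampling without replacement: the images of the points other than [p] are
exchangeable given that of [p], and together with it their values under [a] sum
to zero. *)
Lemma expect_perm_centered (a : 'I_n -> R) p p' : \sum_r a r = 0 -> p != p' ->
  (n%:R - 1) * expect (fun s : 'S_n => a (s p) * a (s p')) =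
  - ((\sum_r a r ^+ 2) / n%:R).
Proof.
move=> a0 pp'.
have same p2 : p2 != p -> expect (fun s : 'S_n => a (s p) * a (s p2)) =
    expect (fun s : 'S_n => a (s p) * a (s p')).
  move=> p2p.
  rewrite -(expect_perm (fun s : 'S_n => a (s p) * a (s p'))
    (mulgI (tperm p' p2))).
  by apply: eq_expect => s; rewrite !permM tpermL tpermD // eq_sym.
apply/eqP; rewrite -addr_eq0 -(expect_perm_point (fun r => a r ^+ 2) p).
apply/eqP.
transitivity (\sum_(p2 < n) expect (fun s : 'S_n => a (s p) * a (s p2))).
  rewrite [RHS](bigD1 p) //= addrC; congr (_ + _).
  rewrite [RHS](eq_bigr _ same) sumr_const cardC1 card_ord -[RHS]mulr_natl.
  by rewrite -subn1 natrB // (leq_ltn_trans _ (ltn_ord p)).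
rewrite -expect_sum -[RHS](expect_cst (1%g : 'S_n)); apply: eq_expect => s.
rewrite -mulr_sumr.
have <- : \sum_r a r = \sum_i a (s i) by rewrite (reindex_inj (@perm_inj _ s)).
by rewrite a0 mulr0.
Qed.

End Permutations.
End Expectation.

(** * Randomly permuted row effects *)

Section RowEffects.
Context {R : realType} {n P : nat}.

Lemma qform_sum (M : 'M[R]_n) (c : 'I_P -> R) (x : 'I_P -> 'cV[R]_n) :
  qform M (\sum_p c p *: x p) =
  \sum_p \sum_p' c p * c p' * bform M (x p) (x p').
Proof.
rewrite /qform mulmx_sumr summxE exchange_big; apply: eq_bigr => p' _.
have -> : (\sum_p c p *: x p)^T = \sum_p c p *: (x p)^T.
  by rewrite linear_sum; apply: eq_bigr => p _; rewrite linearZ.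
rewrite !mulmx_suml summxE; apply: eq_bigr => p _.
by rewrite -!scalemxAl -scalemxAr scalerA mxE.
Qed.

(** The covariances of the effects [a (s p)] take one value on the diagonal and
another off it, so they split the form into a part that sees the rows one by one
and a part that sees their sum. *)
Lemma expect_row_effects (M : 'M[R]_n) (a : 'I_P -> R) (x : 'I_P -> 'cV[R]_n) :
  (1 < P)%N -> \sum_r a r = 0 ->
  expect (fun s : 'S_P => qform M (\sum_p a (s p) *: x p)) =
  (\sum_r a r ^+ 2) / P%:R / (P%:R - 1) *
    (P%:R * (\sum_p qform M (x p)) - qform M (\sum_p x p)).
Proof.
move=> P1 a0; set s2 := _ / P%:R.
have P10 : P%:R - 1 != 0 :> R by rewrite subr_eq0 pnatr_eq1 gtn_eqF.
have qsum : qform M (\sum_p x p) = \sum_p \sum_p' bform M (x p) (x p').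
  under eq_bigr do rewrite -[x _]scale1r.
  by rewrite qform_sum; do 2!apply: eq_bigr => ? _; rewrite !mul1r.
transitivity (\sum_p \sum_p' expect (fun s : 'S_P =>
    bform M (x p) (x p') * (a (s p) * a (s p')))).
  under [RHS]eq_bigr do rewrite -expect_sum.
  rewrite -expect_sum; apply: eq_expect => s; rewrite qform_sum.
  by do 2!apply: eq_bigr => ? _; rewrite mulrC.
rewrite qsum mulr_sumr -sumrB mulr_sumr; apply: eq_bigr => p _.
rewrite (bigD1 p) //= [in RHS](bigD1 p) //=.
rewrite expectZ (expect_perm_point (fun r => a r * a r) p).
have -> : \sum_r a r * a r = \sum_r a r ^+ 2 by [].
have -> : \sum_(i | i != p) expect (fun s : 'S_P =>
    bform M (x p) (x i) * (a (s p) * a (s i))) =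
    - (s2 / (P%:R - 1)) * \sum_(i | i != p) bform M (x p) (x i).
  rewrite mulr_sumr; apply: eq_bigr => p' p'p.
  have pp' : p != p' by rewrite eq_sym.
  rewrite expectZ.
  have /(canRL (mulKf P10)) -> := expect_perm_centered a0 pp'.
  by rewrite -/s2; ring.
rewrite -/s2 -/(bform M (x p) (x p)).
set S := \sum_(i | _) _.
by rewrite /qform -/(bform M (x p) (x p)); field.
Qed.

(** Switching on a single row ([d] true only there) makes the form vanish on
that row; with all rows switched on, what is left in [expect_row_effects] is the
form at the sum. *)
Lemma row_effects_qform_eq0 (M : 'M[R]_n) (a : 'I_P -> R)
    (x : 'I_P -> 'cV[R]_n) :
  (1 < P)%N -> \sum_r a r = 0 -> \sum_r a r ^+ 2 != 0 ->
  (forall d : 'I_P -> bool, expect (fun s : 'S_P =>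
    qform M (\sum_p a (s p) *: ((d p)%:R *: x p))) = 0) ->
  qform M (\sum_p x p) = 0.
Proof.
move=> P1 a0 a2 Ex0.
have P10 : P%:R - 1 != 0 :> R by rewrite subr_eq0 pnatr_eq1 gtn_eqF.
have P0 : P%:R != 0 :> R by rewrite pnatr_eq0 -lt0n ltnW.
have {}Ex0 (d : 'I_P -> bool) :
    P%:R * (\sum_p qform M ((d p)%:R *: x p)) =
    qform M (\sum_p (d p)%:R *: x p).
  apply/eqP; rewrite -subr_eq0; apply/eqP.
  have := Ex0 d; rewrite expect_row_effects // => /eqP.
  by rewrite !mulf_eq0 !invr_eq0 (negPf a2) (negPf P0) (negPf P10) => /eqP.
have row0 p : qform M (x p) = 0.
  have := Ex0 (pred1 p).
  rewrite (bigD1 p) //= [in RHS](bigD1 p) //= eqxx !scale1r.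
  rewrite !big1 ?addr0 => [/eqP|q /negPf ->|q /negPf ->]; rewrite ?scale0r //.
    rewrite -subr_eq0 -{2}[qform _ _]mul1r -mulrBl mulf_eq0 (negPf P10).
    by move=> /eqP.
  by rewrite /qform mulmx0 mxE.
have := Ex0 predT; under eq_bigr do rewrite scale1r row0.
by rewrite big1 // mulr0; under eq_bigr do rewrite scale1r.
Qed.

End RowEffects.

(** * Moments of the estimated contrasts *)

Section StripPlotMoments.
Context {R : realType} {B P Q : nat}.
Variable l : 'I_P -> 'I_Q -> R.
Implicit Types Y : outcomes R B P Q.

Definition block_contrast Y b (u : 'S_P * 'S_Q) : R :=
  \sum_p \sum_q l p q * Y b (u.1 p) (u.2 q) p q.

Lemma expect_block_contrast Y b :
  expect (block_contrast Y b) = taubar_vec l Y b 0.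
Proof.
rewrite expect_sum mxE; apply: eq_bigr => p _.
rewrite expect_sum; apply: eq_bigr => q _.
rewrite expectZ.
rewrite (expect_pair (fun (s : 'S_P) (t : 'S_Q) => Y b (s p) (t q) p q)).
congr (_ * _).
have /eq_expect -> : (fun s : 'S_P =>
      expect (fun t : 'S_Q => Y b (s p) (t q) p q)) =1
    (fun s => (fun r => (\sum_c Y b r c p q) / Q%:R) (s p)).
  by move=> s; rewrite (expect_perm_point (fun c => Y b (s p) c p q)).
rewrite (expect_perm_point (fun r => (\sum_c Y b r c p q) / Q%:R)).
by rewrite /Ybar -mulr_suml invfM mulrA mulrAC.
Qed.

Lemma expect_tauhat_qform (U : 'M[R]_B) Y :
  expect (fun w : randomization B P Q => qform U (tauhat_vec l (Yobs Y w))) =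
  qform U (taubar_vec l Y) +
    \sum_b U b b * Defs.variance (block_contrast Y b).
Proof.
rewrite (expect_qform (1%g, 1%g) U (block_contrast Y)); congr (qform _ _ + _).
by apply/colP => b; rewrite mxE expect_block_contrast.
Qed.

Lemma expect_tauhat Y :
  expect (fun w : randomization B P Q => tauhat l (Yobs Y w)) =
  (\sum_b taubar_vec l Y b 0) / B%:R.
Proof.
rewrite [LHS](_ : _ = expect (fun w : randomization B P Q =>
  B%:R^-1 * \sum_b tauhat_vec l (Yobs Y w) b 0)); last first.
  by apply: eq_expect => w; rewrite mulrC.
rewrite expectZ mulrC expect_sum; congr (_ / _); apply: eq_bigr => b _.
rewrite -expect_block_contrast.
rewrite -(expect_marginal (n := B) (1%g, 1%g) b (block_contrast Y b)).
by apply: eq_expect => w; rewrite mxE.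
Qed.

Lemma var_tauhatE Y :
  var_tauhat l Y = B%:R ^- 2 * \sum_b Defs.variance (block_contrast Y b).
Proof.
have w0 : randomization B P Q := [ffun=> (1%g, 1%g)].
rewrite /var_tauhat (variance_moments w0).
rewrite (eq_expect (fun w => sqr_mean (tauhat_vec l (Yobs Y w)))).
rewrite expect_tauhat_qform expect_tauhat mulr_sumr.
under eq_bigr do rewrite mxE.
rewrite addrAC -[RHS]add0r; congr (_ + _).
by rewrite sqr_mean subrr.
Qed.

(** With diagonal entries 1 / B^2 the block variances enter the mean of the
form and the variance of the average contrast with the same weight. *)
Lemma bias_tauhat_qform (f : estimator R B P Q) (U : 'M[R]_B) Y :
  (forall D, f D = qform U (tauhat_vec l D)) ->
  (forall b, U b b = B%:R ^- 2) ->
  Eest f Y - var_tauhat l Y = qform U (taubar_vec l Y).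
Proof.
move=> fE Ubb; rewrite /Eest (eq_expect (fun w => fE (Yobs Y w))).
rewrite expect_tauhat_qform var_tauhatE mulr_sumr.
by under eq_bigr do rewrite Ubb; rewrite addrK.
Qed.

(** Under additivity the means of two blocks differ by the same amount for all
treatment combinations, which a contrast does not see. *)
Lemma additive_taubar Y b b' : \sum_p \sum_q l p q = 0 ->
  between_block_additive Y -> taubar_vec l Y b 0 = taubar_vec l Y b' 0.
Proof.
move=> l0 addY; apply/eqP; rewrite -subr_eq0 !mxE -sumrB.
under eq_bigr do rewrite -sumrB.
case: (pickP (fun _ : 'I_P * 'I_Q => true)) => [[p0 q0] _|none].
  pose d := Ybar Y b p0 q0 - Ybar Y b' p0 q0.
  apply/eqP; transitivity (\sum_p \sum_q l p q * d); last first.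
    by under eq_bigr do rewrite -mulr_suml; rewrite -mulr_suml l0 mul0r.
  apply: eq_bigr => p _; apply: eq_bigr => q _.
  rewrite -mulrBr; congr (_ * _).
  by rewrite /d; have := addY p q p0 q0 b b'; lra.
(* Without treatment combinations both contrasts are empty sums. *)
rewrite big1 // => p _; rewrite big1 // => q _.
by have := none (p, q).
Qed.

End StripPlotMoments.

(** * What unbiasedness forces on a quadratic estimator *)

Section Unbiasedness.
Context {R : realType} {B P Q : nat}.
Variable l : 'I_P -> 'I_Q -> R.
Hypothesis l_sum0 : \sum_p \sum_q l p q = 0.
Variable A : 'M[R]_(B * (P * Q)).
Hypothesis A_psd : nonneg_definite A.
Implicit Types Y : outcomes R B P Q.

Definition unbiased_at Y : Prop :=
  Eest (fun D => qform A (stack D)) Y = var_tauhat l Y.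

Definition constant_outcomes (D : observation R B P Q) : outcomes R B P Q :=
  fun b _ _ p q => D b p q.

Let w0 : randomization B P Q := [ffun=> (1%g, 1%g)].

(** Without unit effects the randomization does not influence the observation,
so the variance to be estimated is zero. *)
Lemma unbiased_constant_ker (D : observation R B P Q) :
  unbiased_at (constant_outcomes D) -> A *m stack D = 0.
Proof.
move=> unbD; apply: nonneg_definite_ker => //.
rewrite -(expect_cst w0 (qform A (stack D))).
transitivity (Defs.variance (fun _ : randomization B P Q => tauhat l D)).
  exact: unbD.
by rewrite /Defs.variance !(expect_cst w0) subrr expr0n.
Qed.

Lemma tauhat_affine (x0 e : R) (D : observation R B P Q) :
  tauhat l (fun b p q => e * D b p q + x0) = e * tauhat l D.
Proof.
rewrite /tauhat mulrA mulr_sumr; congr (_ / _); apply: eq_bigr => b _.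
have l0 : \sum_p \sum_q l p q * x0 = 0.
  by under eq_bigr do rewrite -mulr_suml; rewrite -mulr_suml l_sum0 mul0r.
rewrite !mxE -[RHS]addr0 -[X in _ = _ + X]l0 mulr_sumr -big_split.
apply: eq_bigr => p _.
rewrite mulr_sumr -big_split; apply: eq_bigr => q _ /=; ring.
Qed.

Lemma Ybar_affine (x0 e : R) Y b p q : (0 < P)%N -> (0 < Q)%N ->
  Ybar (fun b r c p q => e * Y b r c p q + x0) b p q = e * Ybar Y b p q + x0.
Proof.
move=> P0 Q0; rewrite /Ybar.
under eq_bigr do rewrite big_split -mulr_sumr sumr_const card_ord.
rewrite big_split -mulr_sumr sumr_const card_ord /=.
rewrite -(mulr_natr x0) -[_ *+ P]mulr_natr.
by field; rewrite !pnatr_eq0 -!lt0n Q0 P0.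
Qed.

Lemma interval_ball (T : set R) : is_interval T ->
  (exists x y, [/\ T x, T y & x < y]) ->
  exists x0 d : R, 0 < d /\ forall z, `|z| <= d -> T (z + x0).
Proof.
move=> itvT [x [y [Tx Ty xy]]]; exists ((x + y) / 2%:R), ((y - x) / 2%:R).
split=> [|z]; first lra.
rewrite ler_norml => /andP[z1 z2]; apply: (itvT x y Tx Ty).
by apply/andP; split; lra.
Qed.

(** [e * Y + x0] has values in [T] when [x0] is inside [T] and [e] is small. The
shift adds a vector of the kernel of [A] and leaves the contrast unchanged; the
scaling multiplies both sides by [e ^+ 2]. *)
Lemma unbiased_extend (T : set R) :
  (0 < P)%N -> (0 < Q)%N -> is_interval T ->
  (exists x y, [/\ T x, T y & x < y]) ->
  (forall Y, valued_in T Y -> between_block_additive Y -> unbiased_at Y) ->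
  forall Y, between_block_additive Y -> unbiased_at Y.
Proof.
move=> P0 Q0 itvT ndT unbT Y addY.
have [x0 [d [d0 Td]]] := interval_ball itvT ndT.
pose S : R := \sum_(i : 'I_B * 'I_P * 'I_Q * 'I_P * 'I_Q)
  `|Y i.1.1.1.1 i.1.1.1.2 i.1.1.2 i.1.2 i.2|.
have S0 : 0 < 1 + S by rewrite ltr_pwDl // sumr_ge0.
(* [S] bounds all outcomes; the 1 covers the array of zeros. *)
pose e := d / (1 + S).
have e0 : 0 < e by rewrite divr_gt0.
have Ax0 : A *m stack (fun _ _ _ => x0) = 0.
  apply: unbiased_constant_ker; apply: unbT => [b r c p q|p1 q1 p2 q2 b b'].
    by rewrite -[T _]/(T x0) -[x0]add0r; apply: Td; rewrite normr0 ltW.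
  by rewrite /Ybar /constant_outcomes !subrr.
have : unbiased_at (fun b r c p q => e * Y b r c p q + x0).
  apply: unbT => [b r c p q|p1 q1 p2 q2 b b'].
    apply: Td; rewrite normrM gtr0_norm // /e mulrAC ler_pdivrMr //.
    rewrite (ler_wpM2l (ltW d0)) // /S (bigD1 (b, r, c, p, q)) //=.
    by rewrite addrCA lerDl addr_ge0 // sumr_ge0.
  rewrite !Ybar_affine //; have := addY p1 q1 p2 q2 b b' => h.
  have: e * (Ybar Y b p1 q1 - Ybar Y b p2 q2) =
        e * (Ybar Y b' p1 q1 - Ybar Y b' p2 q2) by rewrite h.
  lra.
rewrite /unbiased_at /Eest /var_tauhat /Defs.variance.
have /eq_expect -> : (fun w : randomization B P Q => qform A (stack
    (Yobs (fun b r c p q => e * Y b r c p q + x0) w))) =1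
    (fun w => e ^+ 2 * qform A (stack (Yobs Y w))).
  move=> w; rewrite -qformZ -[RHS](qform_addl_ker _ A_psd.1 Ax0); congr qform.
  by rewrite addrC -stack_lincomb; apply: eq_stack.
have tE : (fun w : randomization B P Q => tauhat l
    (Yobs (fun b r c p q => e * Y b r c p q + x0) w)) =1
    (fun w => e * tauhat l (Yobs Y w)).
  by move=> w; rewrite -(tauhat_affine x0).
rewrite (eq_expect tE) 2!expectZ.
set m := expect (fun w => tauhat l _).
have /eq_expect -> : (fun w : randomization B P Q => (tauhat l
    (Yobs (fun b r c p q => e * Y b r c p q + x0) w) - e * m) ^+ 2) =1
    (fun w => e ^+ 2 * (tauhat l (Yobs Y w) - m) ^+ 2).
  by move=> w; rewrite tE -mulrBr exprMn.
by rewrite expectZ => /mulfI -> //; rewrite sqrf_eq0 gt_eqF.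
Qed.

Hypothesis unbiased : forall Y, between_block_additive Y -> unbiased_at Y.
Hypothesis P1 : (1 < P)%N.

Definition in_block b (v : 'I_P -> 'I_Q -> R) : 'cV[R]_(B * (P * Q)) :=
  stack (fun b' p q => (b' == b)%:R * v p q).

Lemma contrast_in_block b v b' :
  (contrast_mx l *m in_block b v) b' 0 =
  (b' == b)%:R * \sum_p \sum_q l p q * v p q.
Proof.
rewrite -tauhat_vecE mxE mulr_sumr; apply: eq_bigr => p _.
by rewrite mulr_sumr; apply: eq_bigr => q _; ring.
Qed.

Lemma stack_row_effects b (a : 'I_P -> R) v :
  stack (fun b' p q => (b' == b)%:R * (a p * v p q)) =
  \sum_p a p *: in_block b (fun p' q => (p' == p)%:R * v p' q).
Proof.
apply/colP => k; case/mxvec_indexP: k => b' k; case/mxvec_indexP: k => p q.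
rewrite summxE stackE (bigD1 p) //= big1 => [|p' pp'].
  by rewrite mxE stackE eqxx addr0 mul1r mulrCA.
by rewrite mxE stackE [p == p']eq_sym (negPf pp') mul0r !mulr0.
Qed.

Lemma in_block_sum b v : in_block b v =
  \sum_p in_block b (fun p' q => (p' == p)%:R * v p' q).
Proof.
transitivity (stack (fun b' p q => (b' == b)%:R * (1 * v p q))).
  by apply: eq_stack => b' p q; rewrite mul1r.
rewrite (stack_row_effects b (fun=> 1)).
by apply: eq_bigr => p _; rewrite scale1r.
Qed.
(** Let the unit in row [r] of block [b] respond [a r * v p q] and all other
blocks respond zero. As [a] is centred, all block means are zero, so the
outcomes are additive and the estimator has the mean of the squared estimated
average contrast. Hence the difference [M] of the two forms has mean zero for all [v],
in particular for [v] restricted to a set of rows, and [row_effects_qform_eq0]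
applies. *)
Lemma qform_in_block b v :
  qform A (in_block b v) = B%:R ^- 2 * (\sum_p \sum_q l p q * v p q) ^+ 2.
Proof.
pose L := contrast_mx (B := B) l.
pose J : 'M[R]_B := const_mx (B%:R ^- 2).
pose M := A - L^T *m J *m L.
have ME D : qform M (stack D) = qform A (stack D) - tauhat l D ^+ 2.
  by rewrite /M qformBl qform_congr -tauhat_vecE -sqr_mean.
suff : qform M (in_block b v) = 0.
  rewrite ME => /eqP; rewrite subr_eq0 => /eqP ->.
  rewrite /tauhat tauhat_vecE exprMn exprVn mulrC; congr (_ * _ ^+ 2).
  rewrite -[RHS](sum_block b (fun=> \sum_p \sum_q l p q * v p q)).
  by apply: eq_bigr => b' _; rewrite contrast_in_block.
have r0 : 'I_P := Ordinal (ltnW P1).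
(* Any centred row effects other than zero would serve. *)
pose a (r : 'I_P) : R := P%:R * (r == r0)%:R - 1.
have a0 : \sum_r a r = 0.
  rewrite sumrB -mulr_sumr sumr_const card_ord (bigD1 r0) //= eqxx big1 ?addr0.
    by rewrite mulr1 subrr.
  by move=> r /negPf ->.
have a2 : \sum_r a r ^+ 2 != 0.
  rewrite gt_eqF // (bigD1 r0) //= ltr_wpDr ?sumr_ge0 // => [r _|].
    exact: sqr_ge0.
  by rewrite exprn_even_gt0 //= /a eqxx mulr1 subr_eq0 pnatr_eq1 gtn_eqF.
rewrite in_block_sum; apply: (row_effects_qform_eq0 P1 a0 a2) => d.
pose v' p q := (d p)%:R * v p q.
pose Y : outcomes R B P Q := fun b' r c p q => (b' == b)%:R * (a r * v' p q).
have Ybar0 b' p q : Ybar Y b' p q = 0.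
  rewrite /Ybar (_ : \sum_r _ = (\sum_r a r) * ((b' == b)%:R * v' p q *+ Q)).
    by rewrite a0 !mul0r.
  rewrite mulr_suml; apply: eq_bigr => r _.
  by rewrite sumr_const card_ord /Y mulrCA mulrnAr.
have tau0 : expect (fun w : randomization B P Q => tauhat l (Yobs Y w)) = 0.
  rewrite expect_tauhat big1 ?mul0r // => b' _; rewrite mxE big1 // => p _.
  by rewrite big1 // => q _; rewrite Ybar0 mulr0.
have /unbiased : between_block_additive Y by move=> *; rewrite !Ybar0.
rewrite /unbiased_at /Eest /var_tauhat (variance_moments w0) tau0.
rewrite expr0n subr0 => /eqP; rewrite -subr_eq0 => /eqP.
rewrite -mulN1r -expectZ -expectD => <-.
pose F (s : 'S_P) := qform M (\sum_p a (s p) *: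
  ((d p)%:R *: in_block b (fun p' q => (p' == p)%:R * v p' q))).
transitivity (expect (fun w : randomization B P Q => F (w b).1)).
  rewrite (expect_marginal (1%g, 1%g) b (fun u : 'S_P * 'S_Q => F u.1)).
  rewrite (expect_pair (fun (s : 'S_P) (_ : 'S_Q) => F s)).
  by apply: eq_expect => s; rewrite (expect_cst (1%g : 'S_Q)).
apply: eq_expect => w; rewrite mulN1r -ME /F; congr qform.
transitivity (stack (fun b' p q => (b' == b)%:R * (a ((w b).1 p) * v' p q))).
  rewrite stack_row_effects; apply: eq_bigr => p _; congr (_ *: _).
  apply/colP => k; rewrite mxE; case/mxvec_indexP: k => b' k.
  case/mxvec_indexP: k => p' q; rewrite !stackE /v'.
  case: (eqVneq p' p) => [->|_]; first by rewrite !mul1r mulrCA.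
  by rewrite !mul0r !mulr0.
apply: eq_stack => b' p q; rewrite /Yobs /Y.
by case: eqP => [->//|_]; rewrite !mul0r.
Qed.

(** [x] is a sum of block vectors, and [qform_in_block] makes the form vanish on
each of them. *)
Lemma contrast_ker (x : 'cV[R]_(B * (P * Q))) :
  contrast_mx l *m x = 0 -> A *m x = 0.
Proof.
move=> Lx0.
have -> : x = \sum_b in_block b (unstack x b).
  apply/colP => k; case/mxvec_indexP: k => b k; case/mxvec_indexP: k => p q.
  rewrite summxE; under eq_bigr do rewrite stackE.
  under eq_bigr do rewrite eq_sym.
  by rewrite (sum_block b (fun b => unstack x b p q)).
rewrite mulmx_sumr big1 // => b _; apply: nonneg_definite_ker => //.
rewrite qform_in_block; have /colP/(_ b) := Lx0.
rewrite -(unstackK x) -tauhat_vecE !mxE unstackK => ->.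
by rewrite expr0n mulr0.
Qed.

Hypothesis l_neq0 : exists p q, l p q != 0.

(** An observation differs from the lift of its contrasts by a vector of the
kernel of [A], so [U] can be taken to be the restriction of [A] to lifts. *)
Lemma unbiased_reduction : exists2 U : 'M[R]_B, weight_mx U &
  forall D, qform A (stack D) = qform U (tauhat_vec l D).
Proof.
have s0 : sqnorm l != 0 by rewrite gt_eqF // sqnorm_gt0.
pose L := lift_mx (B := B) l; exists (L^T *m A *m L).
  split.
  - split=> [|x]; first by rewrite !trmx_mul trmxK A_psd.1 mulmxA.
    by rewrite qform_congr; exact: A_psd.2.
  - move=> b; rewrite -qform_delta qform_congr /L /lift_mx -scalemxAl qformZ.
    rewrite tr_contrast_mx.
    rewrite (eq_stack (D' := fun b' p q => (b' == b)%:R * l p q)).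
      rewrite -/(in_block b l) qform_in_block.
      have -> : \sum_p \sum_q l p q * l p q = sqnorm l by [].
      by rewrite mulrCA -exprMn mulVf // expr1n mulr1.
    by move=> b' p q; rewrite mxE eqxx andbT.
  (* The lift of a constant vector is a multiple of [l] repeated in each block,
     an additive array without unit effects. *)
  - have A1 : A *m (L *m const_mx 1) = 0 :> 'cV_(B * (P * Q)).
      rewrite /L /lift_mx -scalemxAl -scalemxAr tr_contrast_mx.
      rewrite (eq_stack (D' := fun _ p q => l p q)).
        by rewrite unbiased_constant_ker ?scaler0 //; exact: unbiased.
      by move=> b p q; rewrite mxE mul1r.
    move=> b; set U := L^T *m A *m L.
    transitivity ((U *m const_mx 1) b (0 : 'I_1)).
      rewrite [RHS]mxE; apply: eq_bigr => b' _.
      by rewrite [const_mx _ _ _]mxE mulr1.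
    by rewrite /U -!mulmxA A1 mulmx0 mxE.
move=> D; rewrite qform_congr; set x := stack D.
have -> : tauhat_vec l D = contrast_mx l *m x by exact: tauhat_vecE.
rewrite -[in LHS](subrK (L *m (contrast_mx l *m x)) x) qform_addl_ker //.
  exact: A_psd.1.
apply: contrast_ker.
by rewrite mulmxBr (mulmxA _ L) contrast_lift // mul1mx subrr.
Qed.

End Unbiasedness.

(** * The class of estimators and its minimax member *)

Section ClassV.
Context {R : realType} {B P Q : nat}.
Hypotheses (B1 : (1 < B)%N) (P1 : (1 < P)%N) (Q1 : (1 < Q)%N).
Variable l : 'I_P -> 'I_Q -> R.
Hypotheses (l_neq0 : exists p q, l p q != 0) (l_sum0 : \sum_p \sum_q l p q = 0).
Variable T : set R.
Hypotheses (T_interval : is_interval T)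
  (T_nondegenerate : exists x y, [/\ T x, T y & x < y]).

Definition estimator_of (U : 'M[R]_B) : estimator R B P Q :=
  fun D => qform U (tauhat_vec l D).

(** The bias is [qform U] at the vector of contrasts, which is constant under
between-block additivity. *)
Lemma classV_estimator_of U : weight_mx U -> classV l T (estimator_of U).
Proof.
move=> [[symU Uge0] Ubb U0]; pose L := contrast_mx (B := B) l.
exists (L^T *m U *m L); split.
- split=> [|x]; first by rewrite !trmx_mul trmxK symU mulmxA.
  by rewrite qform_congr.
- by move=> D; rewrite qform_congr -tauhat_vecE.
- move=> Y _ addY; apply/eqP; rewrite -subr_eq0; apply/eqP.
  rewrite (bias_tauhat_qform (U := U)) //.
  have -> : taubar_vec l Y = const_mx (taubar_vec l Y (Ordinal (ltnW B1)) 0).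
    apply/colP => b.
    by rewrite (additive_taubar b (Ordinal (ltnW B1))) // [RHS]mxE.
  by rewrite /qform -mulmxA row_sum0_ker // mulmx0 mxE.
Qed.

Lemma tauhat_vec_surj (t : 'cV[R]_B) :
  exists D : observation R B P Q, tauhat_vec l D = t.
Proof.
exists (unstack (lift_mx l *m t)).
by rewrite tauhat_vecE unstackK mulmxA contrast_lift // mul1mx.
Qed.

Lemma estimator_of_inj (U U' : 'M[R]_B) : U^T = U -> U'^T = U' ->
  estimator_of U =1 estimator_of U' -> U = U'.
Proof.
move=> symU symU' UU'; apply: qform_inj => // t.
by have [D <-] := tauhat_vec_surj t; exact: UU'.
Qed.

(** The estimator determines its matrix because every vector is the vector of
contrasts of some observation. *)
Lemma unique_bias_matrix U : weight_mx U ->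
  unique (bias_matrix l T (estimator_of U)) U.
Proof.
move=> [U_psd Ubb U0]; split.
  by split=> // Y _; exact: bias_tauhat_qform.
move=> U' [U'_psd _ _ UU' _].
by apply: estimator_of_inj; [exact: U_psd.1 | exact: U'_psd.1 | exact: UU'].
Qed.

Lemma max_bias_estimator_of U rho m : weight_mx U ->
  max_bias l T (estimator_of U) rho m <->
  is_maximum [set qform U t | t in sphere rho] m.
Proof.
move=> admU; have uniqU := unique_bias_matrix admU; split=> [|maxm].
  by move=> [U' [[bU' _] maxm]]; rewrite (uniqU.2 U' bU').
by exists U.
Qed.

Lemma classV_estimatorP (f : estimator R B P Q) : classV l T f ->
  exists2 U, weight_mx U & f = estimator_of U.
Proof.
move=> [A [A_psd fA unbA]].
have [P0 Q0] : (0 < P)%N /\ (0 < Q)%N by split; exact: ltnW.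
have unbT Y : valued_in T Y -> between_block_additive Y -> unbiased_at l A Y.
  move=> TY addY; rewrite /unbiased_at -unbA //.
  by apply: eq_expect => w; rewrite fA.
have unb := unbiased_extend l_sum0 A_psd P0 Q0 T_interval T_nondegenerate unbT.
have [U admU AU] := unbiased_reduction A_psd unb P1 l_neq0.
by exists U => //; apply/funext => D; rewrite fA AU.
Qed.

Lemma var0E : @var0 R B P Q l = estimator_of var0_mx.
Proof.
by apply/funext => D; rewrite /estimator_of qformZl qform_centering_dev.
Qed.

End ClassV.

Theorem theorem4 (R : realType) (B P Q : nat)
    (hB : (2 <= B)%N) (hP : (2 <= P)%N) (hQ : (2 <= Q)%N)
    (l : 'I_P -> 'I_Q -> R)
    (l_neq0 : exists p q, l p q != 0)
    (l_sum0 : \sum_p \sum_q l p q = 0)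
    (T : set R) (T_interval : is_interval T)
    (T_nondegenerate : exists x y, [/\ T x, T y & x < y]) :
  classV l T (@var0 R B P Q l) /\
  forall rho : R, 0 < rho -> unique (minimax l T rho) (@var0 R B P Q l).
Proof.
have char :=
  classV_estimatorP hP hQ l_neq0 l_sum0 T_interval T_nondegenerate.
have adm0 := var0_mx_weights (R := R) hB.
have maxE U rho m := max_bias_estimator_of (U := U) l_neq0 T rho m.
have V0 : classV l T (estimator_of l (var0_mx (B := B))).
  exact: classV_estimator_of.
rewrite var0E //; split=> // rho rho0.
have has_max (U : 'M[R]_B) : weight_mx U ->
    exists m, max_bias l T (estimator_of l U) rho m.
  move=> admU; have [m maxm] := sphere_max U (ltnW hB) (ltW rho0).
  by exists m; apply/maxE.
have max0_le m : max_bias l T (estimator_of l (var0_mx (B := B))) rho m ->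
    m <= rho ^+ 2 * (B%:R * (B%:R - 1))^-1.
  by move=> /(maxE _ _ _ _ adm0); exact: sphere_maximum_var0_mx_le.
have [m0 max_m0] := has_max _ adm0; split.
  split=> //; exists m0; split=> // g /char [U admU ->].
  have [m' max_m'] := has_max _ admU; exists m'; split=> //.
  apply: le_trans (max0_le _ max_m0) _.
  by apply: (sphere_maximum_ge hB rho0 admU); exact/maxE.
move=> f [/char [U admU ->] [m [max_m m_le]]]; congr estimator_of; apply/esym.
have [m' [max_m' mm']] := m_le _ V0.
apply: (sphere_maximum_eq_var0_mx hB rho0 admU (m := m)); first exact/maxE.
exact: le_trans mm' (max0_le _ max_m').
Qed.
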